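(* There exist infinitely many (pairwise non-isomorphic) $4$-regular graphs $G$ with $m(G)=3$.
   Context: Graphs are finite, simple, with at least one vertex. A $k$-list assignment $L$ of a graph $G$ assigns to each vertex $v$ a set $L(v)$ of exactly $k$ colors. A proper $L$-list coloring is a map $c$ on $V(G)$ with $c(v)\in L(v)$ for all $v$ and $c(u)\ne c(v)$ for every edge $uv$. $G$ is uniquely $k$-list colorable (U$k$LC) if there exists a $k$-list assignment $L$ for which $G$ has exactly one proper $L$-list coloring. $G$ has property $M(k)$ if it is not uniquely $k$-list colorable. The $m$-number $m(G)$ is the least positive integer $k$ such that $G$ has property $M(k)$; equivalently, $m(G)-1$ is the largest integer $k$ such that $G$ is U$k$LC. *)

(* Defs.v *)
From mathcomp Require Import all_boot.

Set Implicit Arguments.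
Unset Strict Implicit.
Unset Printing Implicit Defensive.

Record sgraph := SGraph {
  vertex :> finType;
  edge : rel vertex;
  edge_sym : symmetric edge;
  edge_irrefl : irreflexive edge;
  vertex_gt0 : 0 < #|vertex|
}.

Definition graph_iso (G H : sgraph) : Prop :=
  exists f : G -> H, bijective f /\ forall x y, edge (f x) (f y) = edge x y.

Definition regular (d : nat) (G : sgraph) : Prop :=
  forall v : G, #|[set w | edge v w]| = d.

Definition list_assignment (k : nat) (G : sgraph) (C : finType)
    (L : G -> {set C}) : Prop :=
  forall v : G, #|L v| = k.

Definition proper_list_coloring (G : sgraph) (C : finType)
    (L : G -> {set C}) (c : {ffun G -> C}) : Prop :=
  (forall v : G, c v \in L v) /\ (forall u v : G, edge u v -> c u != c v).

(* Since G is finite, a k-list assignment uses finitely many colors; so letting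
   the color type C range over all finite types loses no generality. *)
Definition uniquely_list_colorable (k : nat) (G : sgraph) : Prop :=
  exists (C : finType) (L : G -> {set C}),
    list_assignment k L /\ exists! c : {ffun G -> C}, proper_list_coloring L c.

Definition property_M (k : nat) (G : sgraph) : Prop :=
  ~ uniquely_list_colorable k G.

(* [m_number G k] is the relation m(G) = k. *)
Definition m_number (G : sgraph) (k : nat) : Prop :=
  [/\ 0 < k, property_M k G & forall j, 0 < j -> property_M j G -> k <= j].

(* Main.v *)
Require Import Defs.
From mathcomp Require Import all_boot.

Set Implicit Arguments.
Unset Strict Implicit.
Unset Printing Implicit Defensive.

(** The graphs are the disjoint unions of copies of the octahedron K_{2,2,2}.
    A disjoint union of copies of G is uniquely k-list colorable iff G is, so
    only the octahedron matters. Suppose that c is the unique coloring of the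
    octahedron for some lists of size 3. Each color of the list of v must occur
    on v or on a neighbor of v, hence for every color x, some neighbor of v has
    a color other than x in the list of v. If a part of the octahedron is
    monochromatic of color x, then the vertices of the other two parts P and Q
    can be recolored, those of P with colors from Q, and those of Q with colors
    from P. Otherwise c is injective, and the colors can be shifted along a
    directed cycle of the relation "w is a neighbor of v with c w in the list of
    v". Both give a second coloring. *)

(** * Unique list colorings of an arbitrary graph *)

Section ListColoring.
Variables (G : sgraph) (C : finType) (L : G -> {set C}) (c : {ffun G -> C}).
Hypothesis cP : proper_list_coloring L c.
Hypothesis c_uniq : forall d, proper_list_coloring L d -> c = d.

(** Otherwise recoloring [v] alone with [x] would give a second proper coloring. *)
Lemma list_color_on_neighbor v x :
  x \in L v -> x != c v -> exists2 w, edge v w & c w = x.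
Proof.
case: (cP) => cL cE xL x_neq.
case: (boolP [exists w, edge v w && (c w == x)]) => [/existsP[w /andP[vw /eqP<-]]|].
  by exists w.
rewrite negb_exists => /forallP noW; case/negP: x_neq.
pose d := [ffun u => if u == v then x else c u].
have dP : proper_list_coloring L d.
  split=> [u|u w uw]; rewrite !ffunE.
    by case: eqP => [->|].
  case: (eqVneq u v) => [eu|_]; case: (eqVneq w v) => [ew|_]; last exact: cE.
  - by move: uw; rewrite eu ew edge_irrefl.
  - by have := noW w; rewrite -eu uw eq_sym.
  - by have := noW u; rewrite -ew edge_sym uw.
by rewrite (c_uniq dP) ffunE eqxx.
Qed.

(** A list of at least three colors has one other than [c v] and [x], and it occurs on a
    neighbor. *)
Lemma neighbor_color_avoiding v x : 2 < #|L v| ->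
  exists w, [/\ edge v w, c w \in L v & c w != x].
Proof.
move=> L3; have [y]: exists y, y \in L v :\: [set c v; x].
  apply/set0Pn; rewrite -card_gt0 cardsD subn_gt0.
  rewrite (leq_ltn_trans _ L3) // (leq_trans (subset_leq_card (subsetIr _ _))) //.
  by rewrite cards2 ltnS leq_b1.
rewrite !inE negb_or => /andP[/andP[yc yx] yL].
have [w vw cw] := list_color_on_neighbor yL yc.
by exists w; rewrite cw.
Qed.

Lemma recoloring_fixed (g : G -> G) :
    (forall v, c (g v) \in L v) ->
    (forall v w, edge v w -> c (g v) != c (g w)) ->
  forall v, c (g v) = c v.
Proof.
move=> gL gE v; have dP : proper_list_coloring L [ffun v => c (g v)].
  by split=> [u|u w uw]; rewrite !ffunE; [apply: gL | apply: gE].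
by rewrite {2}(c_uniq dP) ffunE.
Qed.

Lemma unique_coloring_not_injective :
  (forall v, 2 < #|L v|) -> ~ injective c.
Proof.
move=> L3 c_inj; have /card_gt0P[v0 _] := vertex_gt0 G.
have /fin_all_exists[f fP] v := neighbor_color_avoiding (c v) (L3 v).
(* A directed cycle of [f] is obtained as a minimal nonempty stable set [Z]: its image is again
   stable, so [f] permutes [Z]. *)
pose stable (Z : {set G}) := (Z != set0) && (f @: Z \subset Z).
have stableT : stable setT by rewrite /stable subsetT andbT; apply/set0Pn; exists v0.
have [Z /minsetP[/andP[/set0Pn[z zZ] fZ] Zmin] _] := minset_exists stableT.
have imZ : f @: Z = Z.
  apply: Zmin => //; rewrite /stable imsetS // andbT.
  by apply/set0Pn; exists (f z); apply: imset_f.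
have f_inj : {in Z &, injective f} by apply/imset_injP; rewrite imZ.
(* Since [c] and [g] are injective, so is their composite, which is therefore proper on any edge. *)
pose g v := if v \in Z then f v else v.
have g_inj : injective g.
  have fZP v : v \in Z -> f v \in Z by move=> vZ; rewrite (subsetP fZ) ?imset_f.
  move=> v w; rewrite /g; case: ifPn => vZ; case: ifPn => wZ // e.
  - exact: f_inj.
  - by rewrite -e fZP in wZ.
  - by rewrite e fZP in vZ.
have gL v : c (g v) \in L v.
  by rewrite /g; case: ifP => _; [case: (fP v) | case: cP].
have gE v w : edge v w -> c (g v) != c (g w).
  by apply: contraTneq => /c_inj/g_inj->; rewrite edge_irrefl.
have := recoloring_fixed gL gE z; rewrite /g zZ => e.
by case: (fP z) => _ _ /eqP.
Qed.

End ListColoring.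

Lemma uniquely_1_list_colorable (G : sgraph) : uniquely_list_colorable 1 G.
Proof.
exists G, (fun v => [set v]); split=> [v|]; first exact: cards1.
exists [ffun v => v]; split.
  split=> [v|u v]; rewrite !ffunE ?set11 //.
  by apply: contraTneq => ->; rewrite edge_irrefl.
by move=> d [dL _]; apply/ffunP=> v; have /set1P-> := dL v; rewrite ffunE.
Qed.

(** * Disjoint unions of copies of a graph *)

Section Copies.
Variables (n : nat) (G : sgraph).

Definition copies_edge : rel ('I_n.+1 * G) :=
  fun x y => (x.1 == y.1) && edge x.2 y.2.

Lemma copies_edge_sym : symmetric copies_edge.
Proof. by move=> x y; rewrite /copies_edge eq_sym edge_sym. Qed.

Lemma copies_edge_irrefl : irreflexive copies_edge.
Proof. by move=> x; rewrite /copies_edge edge_irrefl andbF. Qed.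

Lemma copies_gt0 : 0 < #|{: 'I_n.+1 * G}|.
Proof. by rewrite card_prod card_ord muln_gt0 vertex_gt0. Qed.

Definition copies : sgraph := SGraph copies_edge_sym copies_edge_irrefl copies_gt0.

Lemma regular_copies d : regular d G -> regular d copies.
Proof.
move=> Gd [i v].
have pair_inj : injective (pair i : G -> copies) by move=> u w [].
rewrite -(Gd v) -[RHS](card_imset _ pair_inj).
apply: eq_card => -[j w]; rewrite inE; apply/andP/imsetP => /=.
  by case=> /eqP<- vw; exists w; rewrite ?inE.
by case=> u; rewrite inE => vu [-> ->].
Qed.

(** From [copies] to [G], restrict to the copy [ord0]: another coloring there would extend by [c] on
    the other copies. Conversely, give every copy the same lists; uniqueness then holds copy by
    copy. *)
Lemma copies_uniquely_list_colorable k :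
  uniquely_list_colorable k copies <-> uniquely_list_colorable k G.
Proof.
split=> -[C [L [Lk [c [[cL cE] c_uniq]]]]].
  exists C, (fun v => L (ord0, v)); split=> [v|]; first exact: Lk.
  exists [ffun v => c (ord0, v)]; split.
    split=> [v|u v uv]; rewrite !ffunE //.
    by apply: cE; rewrite /= /copies_edge eqxx.
  move=> d [dL dE]; pose d' : {ffun copies -> C} :=
    [ffun x => if x.1 == ord0 then d x.2 else c x].
  have d'P : proper_list_coloring L d'.
    split=> [[i v]|[i v] [j w] e]; rewrite !ffunE /=.
      by case: eqP => [->|_]; [apply: dL | apply: cL].
    case/andP: e => /= /eqP<- vw.
    by case: (i == ord0); [apply: dE | apply: cE; rewrite /= /copies_edge eqxx].
  by apply/ffunP=> v; rewrite ffunE (c_uniq _ d'P) ffunE.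
exists C, (fun x => L x.2); split=> [x|]; first exact: Lk.
exists [ffun x => c x.2]; split.
  by split=> [x|x y /andP[_ xy]]; rewrite !ffunE //; apply: cE.
move=> d [dL dE]; apply/ffunP=> -[i v]; rewrite ffunE /=.
have diP : proper_list_coloring L [ffun v => d (i, v)].
  split=> [w|u w uw]; rewrite ffunE; first exact: (dL (i, w)).
  by rewrite ffunE; apply: dE; rewrite /= /copies_edge eqxx.
by rewrite (c_uniq _ diP) ffunE.
Qed.

Lemma m_number_copies k : m_number G k -> m_number copies k.
Proof.
case=> k_gt0 Mk kmin; split=> // [|j j_gt0 Mj].
  by move/copies_uniquely_list_colorable.
by apply: kmin => // /copies_uniquely_list_colorable.
Qed.

End Copies.

(** * The octahedron *)

Lemma ord3_third (k p q r : 'I_3) :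
  p != k -> q != k -> p != q -> r != k -> r != p -> r = q.
Proof.
by move: k p q r; do 4!case=> [[|[|[|//]]] ?]; rewrite -?val_eqE //= => *; apply: val_inj.
Qed.

Definition octahedron_edge : rel ('I_3 * bool) := fun x y => x.1 != y.1.

Lemma octahedron_edge_sym : symmetric octahedron_edge.
Proof. by move=> x y; rewrite /octahedron_edge eq_sym. Qed.

Lemma octahedron_edge_irrefl : irreflexive octahedron_edge.
Proof. by move=> x; rewrite /octahedron_edge eqxx. Qed.

Lemma octahedron_gt0 : 0 < #|{: 'I_3 * bool}|.
Proof. by rewrite card_prod card_ord card_bool. Qed.

Definition octahedron : sgraph :=
  SGraph octahedron_edge_sym octahedron_edge_irrefl octahedron_gt0.

Lemma octahedron_regular : regular 4 octahedron.
Proof.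
move=> [i b]; have -> : [set w | edge ((i, b) : octahedron) w] = setX [set~ i] setT.
  by apply/setP=> -[j b']; rewrite !inE /= /octahedron_edge andbT eq_sym.
by rewrite cardsX cardsC1 card_ord cardsT card_bool.
Qed.

(** The colors are the parts themselves, and the only coloring sends each vertex to its part. The
    lists are {A, B} on part [A], {B, C} on part [C], and one of each on the two vertices of part
    [B]. *)
Lemma octahedron_uniquely_2_list_colorable : uniquely_list_colorable 2 octahedron.
Proof.
have [A [B [C [nBA nBC nAC]]]] :
    exists A B C : 'I_3, [/\ B != A, B != C & A != C].
  by exists ord0, (inord 1), ord_max; rewrite -!val_eqE /= inordK.
have partE (i : 'I_3) : [\/ i = A, i = B | i = C].
  have [->|iA] := eqVneq i A; first by constructor 1.
  have [->|iB] := eqVneq i B; first by constructor 2.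
  by constructor 3; apply: (ord3_third nBA _ nBC iA iB); rewrite eq_sym.
(* m v is the color missing from the list of v. *)
pose m (v : octahedron) :=
  if v.1 == A then C else if v.1 == C then A else if v.2 then A else C.
have mA b : m (A, b) = C by rewrite /m eqxx.
have mB b : m (B, b) = if b then A else C by rewrite /m /= (negPf nBA) (negPf nBC).
have mC b : m (C, b) = A by rewrite /m /= [C == A]eq_sym (negPf nAC) eqxx.
exists 'I_3, (fun v => [set~ m v]); split=> [v|]; first by rewrite cardsC1 card_ord.
exists [ffun v => v.1]; split.
  split=> [[i b]|u v]; rewrite !ffunE // !inE /=.
  case: (partE i) => ->; rewrite ?mA ?mB ?mC //; first by case: b.
  by rewrite eq_sym.
move=> d [dL dE].
have dm v : d v <> m v by apply/eqP; have := dL v; rewrite !inE.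
have dneq i j b b' : i != j -> d (i, b) <> d (j, b').
  by move=> ij; apply/eqP/dE.
(* For i = A or i = C, this leaves no color for the part opposite to i. *)
have dB i b : B != i -> d (i, b) = B -> d (B, true) = C /\ d (B, false) = A.
  move=> Bi e; have nB b' : d (B, b') <> B by rewrite -[RHS]e; apply: dneq.
  have := (dm (B, true), dm (B, false)); rewrite !mB => -[nA nC].
  by case: (partE (d (B, true))) (partE (d (B, false))) => [//|/nB[]|->] [->|/nB[]|].
have dA b : d (A, b) = A.
  case: (partE (d (A, b))) => // e; last by case: (dm (A, b)); rewrite mA.
  have [eT _] := dB _ _ nBA e; case: (partE (d (C, true))) => eC.
  - by case: (dm (C, true)); rewrite mC.
  - by case: (dneq A C b true nAC); rewrite e eC.
  - by case: (dneq B C true true nBC); rewrite eT eC.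
have dC b : d (C, b) = C.
  case: (partE (d (C, b))) => // e; first by case: (dm (C, b)); rewrite mC.
  have [_ eF] := dB _ _ nBC e.
  by case: (dneq B A false true nBA); rewrite eF dA.
apply/ffunP=> -[i b]; rewrite ffunE /=.
case: (partE i) => ->; rewrite ?dA ?dC //.
case: (partE (d (B, b))) => // e.
- by case: (dneq B A b true nBA); rewrite e dA.
- by case: (dneq B C b true nBC); rewrite e dC.
Qed.

Lemma octahedron_property_M3 : property_M 3 octahedron.
Proof.
case=> C [L [L3 [c [cP c_uniq]]]].
have gt2 v : 2 < #|L v| by rewrite L3.
have [cL cE] := cP.
apply: (unique_coloring_not_injective cP c_uniq gt2) => v w cvw.
(* Vertices of equal color are nonadjacent, so they share a part; if they are distinct, that part
   [i] is monochromatic. *)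
have /eqP : v.1 == w.1 by apply: contraTT (introT eqP cvw); apply: cE.
case: v w cvw => [i b] [j b'] /= + ij; rewrite -{j}ij; have [->//|nb e] := eqVneq b b'.
have mono b1 b2 : c (i, b1) = c (i, b2).
  by case: b b' nb e => [] [] //= _ e; case: b1 b2 => [] [].
have /fin_all_exists[f fP] v :=
  neighbor_color_avoiding cP c_uniq (c (i, true)) (gt2 v).
have f1 v : (f v).1 != i.
  case: (f v) (fP v) => j' b1 [_ _]; apply: contra => /= /eqP ->.
  by rewrite (mono b1 true).
(* For [v] outside part [i], [f v] avoids both [i] and the part of [v], so it lies in the third
   part: [g] swaps the two parts other than [i]. *)
pose g (v : octahedron) : octahedron := if v.1 == i then v else f v.
have gL v : c (g v) \in L v.
  by rewrite /g; case: ifP => _; [apply: cL | case: (fP v)].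
have gE v w : edge v w -> c (g v) != c (g w).
  move=> vw; apply: cE; move: vw; rewrite /g /= /octahedron_edge.
  case: (eqVneq v.1 i) => [-> //|vi]; first by case: (eqVneq w.1 i) => // _ _; rewrite eq_sym.
  case: (eqVneq w.1 i) => [-> //|wi] vw.
  case: (fP v) (fP w) => /= fv _ _ [fw _ _].
  have -> : (f v).1 = w.1 by apply: (ord3_third vi wi vw); rewrite // eq_sym.
  exact: fw.
have fixg := recoloring_fixed c_uniq gL gE.
(* Any vertex outside part [i] takes the color of a neighbor, so its color changes. *)
have [j' ji] : exists j' : 'I_3, j' != i.
  by exists (lift i ord0); rewrite eq_sym neq_lift.
have [/cE/eqP ncf _ _] := fP (j', true); case: ncf.
by rewrite -[LHS]fixg /g (negPf ji).
Qed.

Lemma m_number_octahedron : m_number octahedron 3.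
Proof.
split=> // [|[|[|[|j]]] // _ M]; first exact: octahedron_property_M3.
- by case: M; apply: uniquely_1_list_colorable.
- by case: M; apply: octahedron_uniquely_2_list_colorable.
Qed.

Theorem theorem4 :
  exists G : nat -> sgraph,
    (forall i : nat, regular 4 (G i) /\ m_number (G i) 3) /\
    (forall i j : nat, i <> j -> ~ graph_iso (G i) (G j)).
Proof.
exists (fun n => copies n octahedron); split=> [n|i j ij [f [/bij_eq_card + _]]].
  split; [exact/regular_copies/octahedron_regular | exact/m_number_copies/m_number_octahedron].
(* The numbers of vertices, 6(i + 1) and 6(j + 1), differ. *)
by rewrite !card_prod !card_ord card_bool => /eqP; rewrite eqn_pmul2r // => /eqP[].
Qed.
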